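(* Let $(X,D,P)$ be a complete perturbed metric space with exact metric $d=D-P$. Let $S,T:X\to X$ satisfy: (1) $S$ and $T$ are weakly compatible, i.e. $STz=TSz$ for every $z\in X$ with $Sz=Tz$; (2) $T(X)\subseteq S(X)$; (3) $S(X)$ is closed in $(X,d)$; (4) there exists $\alpha\in[0,1)$ such that $D(Tx,Ty)\le\alpha\,D(Sx,Sy)$ for all $x,y\in X$; (5) for this $\alpha$ there exists $\alpha_0\ge 0$ such that $\alpha\,P(Sx,Sy)\le\alpha_0\,d(Sx,Sy)$ for all $x,y\in X$, and $\alpha+\alpha_0<1$. Put $q:=\alpha+\alpha_0$. Let $(x_n)_{n\ge 0}$ be a sequence in $X$ with $Sx_{n+1}=Tx_n$ for all $n\ge 0$, put $y_n:=Tx_n=Sx_{n+1}$, and let $u$ be the unique common fixed point of $S$ and $T$ (which exists under these hypotheses). Then $$d(y_n,u)\le\frac{q^{\,n}}{1-q}\;D(y_0,y_1),\qquad n\ge 0.$$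
   Context: A perturbed metric space $(X,D,P)$ consists of a set $X$ and two functions $D,P:X\times X\to[0,\infty)$ such that $d(x,y):=D(x,y)-P(x,y)$ is a metric on $X$, called the exact metric. Neither $D$ nor $P$ is assumed symmetric. $(X,D,P)$ is called complete if the metric space $(X,d)$ is complete. *)

(* Defs.v *)
From HB Require Import structures.
From mathcomp Require Import all_boot all_order all_algebra.
From mathcomp Require Import all_classical all_reals all_analysis.

Set Implicit Arguments.
Unset Strict Implicit.
Unset Printing Implicit Defensive.

Import Order.TTheory GRing.Theory Num.Theory.

Local Open Scope classical_set_scope.
Local Open Scope ring_scope.

(* A perturbed metric space (X, D, P): neither D nor P is assumed symmetric;
   the last four fields say that d = D - P is a metric.  Nonnegativity of d
   follows from them, and is derived by the factory isMetric below. *)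
Record perturbedMetric (R : realType) := PerturbedMetric {
  pm_sort :> Type ;
  distD : pm_sort -> pm_sort -> R ;
  distP : pm_sort -> pm_sort -> R ;
  distD_ge0 : forall x y, 0 <= distD x y ;
  distP_ge0 : forall x y, 0 <= distP x y ;
  exact_xx : forall x, distD x x - distP x x = 0 ;
  exact_positivity : forall x y, distD x y - distP x y = 0 -> x = y ;
  exact_sym : forall x y, distD x y - distP x y = distD y x - distP y x ;
  exact_triangle : forall y x z,
    distD x z - distP x z <=
      (distD x y - distP x y) + (distD y z - distP y z)
}.

Section exact_metric.
Context {R : realType} (X : perturbedMetric R).

HB.instance Definition _ := gen_eqMixin (pm_sort X).
HB.instance Definition _ := gen_choiceMixin (pm_sort X).
(* The topology and uniformity of X are those of the exact metric, and
   [mdist x y] is convertible to [distD x y - distP x y]. *)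
HB.instance Definition _ := @isMetric.Build R (pm_sort X)
  (fun x y : X => distD x y - distP x y)
  (@exact_xx R X) (@exact_positivity R X) (@exact_sym R X)
  (@exact_triangle R X).

Lemma exact_mdistE (x y : X) : mdist x y = distD x y - distP x y.
Proof. by []. Qed.

(* Sequential completeness of (X, d); the library's [completeType] would
   require in addition a distinguished point in X. *)
Definition complete_perturbed : Prop :=
  forall y : nat -> X, cauchy (y @ \oo) -> exists l : X, y @ \oo --> l.

End exact_metric.

Definition weakly_compatible (X : Type) (S T : X -> X) : Prop :=
  forall z, S z = T z -> S (T z) = T (S z).

Definition common_fixed_point (X : Type) (S T : X -> X) (u : X) : Prop :=
  S u = u /\ T u = u.

(* Main.v *)
(* The exact metric satisfies Jungck's condition with constant q:
   d(Ta, Tb) <= D(Ta, Tb) <= alpha (d + P)(Sa, Sb) <= q d(Sa, Sb).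
   Hence (y_n) is Cauchy, its limit is some S z by closedness, T z = S z, and
   weak compatibility makes this coincidence value the common fixed point u.
   The error bound comes from d(y_n, u) <= d(y_n, y_(n+1)) + q d(y_n, u). *)
Require Import Defs.
From HB Require Import structures.
From mathcomp Require Import all_boot all_order all_algebra.
From mathcomp Require Import all_classical all_reals all_analysis.
From mathcomp Require Import lra.

Set Implicit Arguments.
Unset Strict Implicit.
Unset Printing Implicit Defensive.

Import Order.TTheory GRing.Theory Num.Theory.
Import numFieldNormedType.Exports metricType_numDomainType.

Local Open Scope classical_set_scope.
Local Open Scope ring_scope.

Section geometric_steps.
Context {R : realType} {V : metricType R}.
Implicit Types (y : nat -> V) (q : R).

Lemma mdist_contract_eq q (a b : V) :
  q < 1 -> mdist a b <= q * mdist a b -> a = b.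
Proof.
move=> q1 abq; apply: mdist_positivity; have := mdist_ge0 a b; nra.
Qed.

Lemma mdist_step_le q y : 0 <= q ->
    (forall n, mdist (y n.+1) (y n.+2) <= q * mdist (y n) (y n.+1)) ->
  forall n, mdist (y n) (y n.+1) <= q ^+ n * mdist (y 0%N) (y 1%N).
Proof.
move=> q0 yq; elim=> [|n IH]; first by rewrite expr0 mul1r.
by rewrite (le_trans (yq n))// exprS -mulrA ler_wpM2l.
Qed.

(** Induction on [m] with [n] free: passing through [y n.+1] gives at most (1 - q) d_n + d_(n+1) <=
    (1 - q) d_n + q d_n = d_n, where d_n is the [n]-th step. The factor [1 - q] on the left avoids
    summing a geometric series. *)
Lemma mdist_tail_le q y : 0 <= q -> q < 1 ->
    (forall n, mdist (y n.+1) (y n.+2) <= q * mdist (y n) (y n.+1)) ->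
  forall m n, (1 - q) * mdist (y n) (y (n + m)%N) <= mdist (y n) (y n.+1).
Proof.
move=> q0 q1 yq; elim=> [|m IH] n; first by rewrite addn0 mdistxx mulr0 mdist_ge0.
have := IH n.+1; rewrite addSnnS => IHn.
have q1_ge0 : 0 <= 1 - q by rewrite subr_ge0 ltW.
have := ler_wpM2l q1_ge0 (metric_triangle (y n) (y n.+1) (y (n + m.+1)%N)).
have := yq n; lra.
Qed.

Lemma cauchy_geometric_steps q y : 0 <= q -> q < 1 ->
    (forall n, mdist (y n.+1) (y n.+2) <= q * mdist (y n) (y n.+1)) ->
  cauchy (y @ \oo).
Proof.
move=> q0 q1 yq; apply: cauchy_exP => e e0.
have qe_gt0 : 0 < (1 - q) * e by rewrite mulr_gt0// subr_gt0.
have : geometric (mdist (y 0%N) (y 1%N)) q @ \oo --> (0 : R).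
  by apply: cvg_geometric; rewrite ger0_norm.
move=> /cvgr0_norm_lt/(_ _ qe_gt0)[N _ /(_ N (leqnn N))/=].
move=> /(le_lt_trans (ler_norm _)) N_lt.
(* A single ball containing a tail suffices; its centre is [y N], where [N] makes the bound q^N
   d(y_0, y_1) on the [N]-th step smaller than (1 - q) e. *)
exists (y N); exists N => // n /= /subnKC <-.
rewrite ballEmdist/= -(@ltr_pM2l _ (1 - q)) ?subr_gt0//.
apply: le_lt_trans N_lt; rewrite [leRHS]mulrC.
by rewrite (le_trans (mdist_tail_le q0 q1 yq _ N)) ?mdist_step_le.
Qed.

End geometric_steps.

Section jungck.
Context {R : realType} {V : metricType R}.
Variables (S T : V -> V) (q : R).
Hypothesis q_lt1 : q < 1.
Hypothesis ST_contraction :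
  forall a b, mdist (T a) (T b) <= q * mdist (S a) (S b).

(** No continuity of [S] or [T] is involved: since [S (x N.+1)] is [T (x N)], d(S z, T z) is at most
    d(S z, T x_(N+1)) + q d(T x_N, S z), and both terms tend to 0. *)
Lemma coincidence_of_limit (x : nat -> V) (z : V) :
    (forall n, S (x n.+1) = T (x n)) -> T (x n) @[n --> \oo] --> S z ->
  T z = S z.
Proof.
move=> xE /cvgrPdist_lt Tx_cvg.
apply/esym/mdist_positivity/eqP; rewrite eq_le mdist_ge0 andbT.
apply/ler_addgt0Pl => /= e e0; rewrite addr0.
have [N _ xN] := Tx_cvg (e / 2) (divr_gt0 e0 (ltr0Sn _ 1)).
have /= dN := xN N (leqnn N); have /= dN1 := xN N.+1 (leqnSn N).
have := metric_triangle (S z) (T (x N.+1)) (T z).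
have := ST_contraction (x N.+1) z.
rewrite xE (metric_sym (T (x N))).
have := ler_piMl (mdist_ge0 (S z) (T (x N))) (ltW q_lt1); lra.
Qed.

(** Contracting the pair (S z, z) bounds d(T (S z), S z) by [q] times itself, so it vanishes; the
    pair (S z, v) gives uniqueness in the same way. *)
Lemma unique_common_fixed_point (z : V) :
  weakly_compatible S T -> T z = S z -> unique (common_fixed_point S T) (S z).
Proof.
move=> wc TSz; have STSz : S (S z) = T (S z) by rewrite -{1}TSz wc.
have Tfix : T (S z) = S z.
  apply: (mdist_contract_eq q_lt1).
  by have := ST_contraction (S z) z; rewrite STSz TSz.
split=> [|v [Sv Tv]]; first by split; rewrite ?STSz.
apply: (mdist_contract_eq q_lt1).
by have := ST_contraction (S z) v; rewrite STSz Tfix Sv Tv.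
Qed.

End jungck.

Lemma exact_contraction (R : realType) (X : perturbedMetric R)
    (S T : X -> X) (alpha alpha0 : R)
    (contraction : forall a b : X,
      distD (T a) (T b) <= alpha * distD (S a) (S b))
    (perturbation : forall a b : X,
      alpha * distP (S a) (S b) <= alpha0 * mdist (S a) (S b)) (a b : X) :
  mdist (T a) (T b) <= (alpha + alpha0) * mdist (S a) (S b).
Proof.
have := contraction a b; have := perturbation a b.
rewrite !exact_mdistE; have := distP_ge0 (T a) (T b); lra.
Qed.

Theorem proposition3p23 (R : realType) (X : perturbedMetric R)
    (S T : X -> X) (alpha alpha0 : R) (x : nat -> X)
    (Xcomplete : complete_perturbed X)
    (ST_wc : weakly_compatible S T)
    (TX_sub_SX : range T `<=` range S)
    (SX_closed : closed (range S))
    (alpha_ge0 : 0 <= alpha) (alpha_lt1 : alpha < 1)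
    (contraction : forall a b : X,
      distD (T a) (T b) <= alpha * distD (S a) (S b))
    (alpha0_ge0 : 0 <= alpha0)
    (perturbation : forall a b : X,
      alpha * distP (S a) (S b) <= alpha0 * mdist (S a) (S b))
    (q_lt1 : alpha + alpha0 < 1)
    (x_iter : forall n : nat, S (x n.+1) = T (x n)) :
  let q := alpha + alpha0 in
  let y := fun n : nat => T (x n) in
  exists u : X,
    unique (common_fixed_point S T) u /\
    forall n : nat, mdist (y n) u <= q ^+ n / (1 - q) * distD (y 0%N) (y 1%N).
Proof.
move=> q y.
have q_ge0 : 0 <= q by rewrite addr_ge0.
have ST_q := exact_contraction contraction perturbation.
have y_step n : mdist (y n.+1) (y n.+2) <= q * mdist (y n) (y n.+1).
  by have := ST_q (x n.+1) (x n.+2); rewrite !x_iter.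
have [l y_cvg] := Xcomplete _ (cauchy_geometric_steps q_ge0 q_lt1 y_step).
have [z _ zl] : range S l.
  apply: (closed_cvg (range S) SX_closed _ _ y_cvg).
  (* Every y_n is the [S]-value of the next iterate, so the whole sequence lies in the closed
     set. *)
  by apply: nearW => n; exists (x n.+1) => //; exact: x_iter.
rewrite -{l}zl in y_cvg.
have TSz := coincidence_of_limit q_lt1 ST_q x_iter y_cvg.
have uniq_u := unique_common_fixed_point q_lt1 ST_q ST_wc TSz.
exists (S z); split=> // n; have [[Su Tu] _] := uniq_u.
rewrite mulrAC ler_pdivlMr ?subr_gt0//.
have yn_le : mdist (y n) (S z) * (1 - q) <= mdist (y n) (y n.+1).
  have := metric_triangle (y n) (y n.+1) (S z).
  (* As [S z] is fixed by both maps and [S (x n.+1)] is [y n], this reads d(y_(n+1), u) <= q d(y_n,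
     u). *)
  have := ST_q (x n.+1) (S z); rewrite Su Tu x_iter -/(y n) -/(y n.+1) -/q; nra.
apply: (le_trans yn_le); apply: (le_trans (mdist_step_le q_ge0 y_step n)).
(* The bound is now q^n d(y_0, y_1), and d <= D because P is nonnegative. *)
rewrite ler_wpM2l ?exprn_ge0// exact_mdistE gerBl; exact: distP_ge0.
Qed.
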